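(* (a) Let $G=c_1+c_2+\cdots+c_n$ be a disjoint union of $n\ge 1$ chains of lengths $c_1,\dots,c_n\ge 4$. Then $v(G)=cv(G)=4+\sum_{i=1}^n(c_i-4)\ge 4$. (b) Let $G=c_1+c_2+\cdots+c_n$ be a disjoint union of $n\ge 1$ chains of lengths $c_1,\dots,c_n\ge 3$, and let $c=cv(G)=4+\sum_{i=1}^n(c_i-4)$. If $c\ge 1$ then $v(G)=c$. If $c\le 0$ then $v(G)\in\{1,2\}$ and $v(G)\equiv c \pmod 2$.
   Context: Game. A dots and boxes game (position) $G$ consists of a finite set of unclaimed boxes and a finite set of undrawn lines, each undrawn line bordering either exactly one box or exactly two distinct boxes, each box being bordered by at least one and at most four undrawn lines. Two players play. The player to move draws (removes) an undrawn line; every box none of whose bordering lines is still undrawn is then claimed by that player. If the move claims at least one box the same player must move again (if a line remains); otherwise the other player moves. Claiming a box when possible is not compulsory. The game ends when no line remains. Each player maximises (own boxes) minus (opponent's boxes), counting only boxes claimed from $G$ onwards. Value. $v(G)$ is the net score, under optimal play, of the player who is NOT to move in $G$. Equivalently, $v(G)=0$ if $G$ has no undrawn lines, and otherwise $v(G)=\min_m v(G;m)$ over undrawn lines $m$, where, if drawing $m$ claims $k$ boxes and leaves the position $G_m$, then $v(G;m)=v(G_m)-k$ if $k\ge1$ and $v(G;m)=-v(G_m)$ if $k=0$. Sums and chains. $G+H$ is the disjoint union. An $n$-chain (chain of length $n$), denoted $n$, is the position with boxes $b_1,\dots,b_n$ and lines $e_0,\dots,e_n$, where $e_i$ borders $b_i$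 and $b_{i+1}$ for $1\le i\le n-1$, $e_0$ borders only $b_1$ and $e_n$ borders only $b_n$. The number $cv(G)$ is the controlled value; for a non-empty union of chains of lengths $c_i\ge3$ it is $4+\sum_i(c_i-4)$. *)

(* Defs.v *)
From HB Require Import structures.
From mathcomp Require Import all_boot all_order all_algebra.

Set Implicit Arguments.
Unset Strict Implicit.
Unset Printing Implicit Defensive.

Import Order.TTheory GRing.Theory Num.Theory.
Local Open Scope ring_scope.

(* Dots and boxes positions. [box] and [line] are ambient index types: the
   undrawn lines are those in [undrawn], and the boxes of the position are the
   unclaimed ones, i.e. those bordered by at least one undrawn line (see
   [unclaimed]). Drawn lines and claimed boxes play no role. *)
Record position := Position {
  box : finType;
  line : finType;
  border : line -> {set box};
  undrawn : {set line};
  line_wf : forall l, l \in undrawn -> (1 <= #|border l| <= 2)%N;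
  box_wf : forall b, (#|[set l in undrawn | b \in border l]| <= 4)%N
}.

Definition unclaimed (G : position) : {set box G} :=
  [set b | [exists l in undrawn G, b \in border l]].

Section Draw.
Variables (G : position) (m : line G).

Fact draw_line_wf l : l \in undrawn G :\ m -> (1 <= #|border l| <= 2)%N.
Proof. by move=> /setD1P[_ /line_wf]. Qed.

Fact draw_box_wf b :
  (#|[set l in undrawn G :\ m | b \in border l]| <= 4)%N.
Proof.
apply: leq_trans (box_wf b); apply/subset_leq_card/subsetP => l.
by rewrite !inE => /andP[/andP[_ ->] ->].
Qed.

Definition draw : position := Position draw_line_wf draw_box_wf.

Definition captures : nat := #|unclaimed G :\: unclaimed draw|.

End Draw.

(* The net score of the player not to move, when [draw G m] has value [x]. *)
Definition move_score (G : position) (m : line G) (x : int) : int :=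
  if (0 < captures m)%N then x - (captures m)%:Z else - x.

(* [k] is the number of undrawn lines. The default element of the iterated
   minimum is one of its terms, so it does not affect the result. *)
Fixpoint value_rec (k : nat) (G : position) : int :=
  if k isn't k'.+1 then 0 else
  let score m := move_score m (value_rec k' (draw m)) in
  if [pick m in undrawn G] is Some m0
  then \big[Num.min/score m0]_(m in undrawn G) score m
  else 0.

(* v(G) and v(G; m); [value_no_line], [value_le] and [value_attained] give the
   recursion v(G) = 0 if G has no undrawn line, v(G) = min_m v(G; m) if not. *)
Definition value (G : position) : int := value_rec #|undrawn G| G.

Definition value_after (G : position) (m : line G) : int :=
  move_score m (value (draw m)).

Lemma value_no_line G : undrawn G = set0 -> value G = 0.
Proof. by move=> G0; rewrite /value G0 cards0. Qed.

Lemma valueE G m0 : m0 \in undrawn G -> exists2 m1, m1 \in undrawn G &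
  value G = \big[Num.min/value_after m1]_(m in undrawn G) value_after m.
Proof.
move=> m0G; rewrite /value (cardsD1 m0) m0G /=.
case: pickP => [m1 m1G|/(_ m0)]; last by rewrite m0G.
have scoreE m : m \in undrawn G ->
    move_score m (value_rec #|undrawn G :\ m0| (draw m)) = value_after m.
  move=> mG; rewrite /value_after /value /=; congr (move_score m (value_rec _ _)).
  by have := cardsD1 m0 (undrawn G); rewrite (cardsD1 m) m0G mG => -[].
by exists m1 => //; rewrite scoreE //; apply: eq_bigr.
Qed.

Lemma value_le G m : m \in undrawn G -> value G <= value_after m.
Proof.
by move=> mG; have [m1 _ ->] := valueE mG; apply: bigmin_le_cond.
Qed.

Lemma value_attained G : undrawn G != set0 ->
  exists2 m, m \in undrawn G & value G = value_after m.
Proof.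
case/set0Pn => m0 /valueE[m1 m1G ->].
elim/big_ind: _ => [|x y [m mG ->] [m' m'G ->]|m mG]; try by [exists m1|exists m].
by rewrite minEle; case: ifP => _; [exists m|exists m'].
Qed.

Section Chain.
Variable n : nat.

(* Boxes are numbered from 0: box i lies between lines i and i + 1. *)
Definition chain_border (e : 'I_n.+1) : {set 'I_n} :=
  [set b : 'I_n | (e == b :> nat) || (e == b.+1 :> nat)].

(* All lines are undrawn for 0 < n; the 0-chain is the empty position. *)
Definition chain_undrawn : {set 'I_n.+1} := [set e | (0 < n)%N].

Fact chain_line_wf e : e \in chain_undrawn -> (1 <= #|chain_border e| <= 2)%N.
Proof.
rewrite inE => n_gt0; apply/andP; split.
  have lt_e1 : (e.-1 < n)%N by case: e => -[|e] //=; rewrite ltnS.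
  apply/card_gt0P; exists (Ordinal lt_e1); rewrite inE /=.
  by case: e {lt_e1} => -[|e] /= _; rewrite ?eqxx ?orbT.
rewrite cardE -(size_map val) -[2%N]/(size [:: val e; e.-1]).
apply: uniq_leq_size => [|_ /mapP[b be ->]].
  by rewrite (map_inj_uniq val_inj) enum_uniq.
by move: be; rewrite mem_enum !inE /= => /orP[]/eqP->; rewrite eqxx ?orbT.
Qed.

Fact chain_box_wf b :
  (#|[set e in chain_undrawn | b \in chain_border e]| <= 4)%N.
Proof.
rewrite cardE -(size_map val); apply: (@leq_trans 2) => //.
rewrite -[2%N]/(size [:: val b; b.+1]).
apply: uniq_leq_size => [|_ /mapP[e be ->]].
  by rewrite (map_inj_uniq val_inj) enum_uniq.
by move: be; rewrite mem_enum !inE => /andP[_].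
Qed.

Definition chain : position := Position chain_line_wf chain_box_wf.

End Chain.

Section Sum.
Variables G H : position.

Definition sum_border (l : line G + line H) : {set box G + box H} :=
  match l with
  | inl g => inl @: border g
  | inr h => inr @: border h
  end.

Definition sum_undrawn : {set line G + line H} :=
  inl @: undrawn G :|: inr @: undrawn H.

Let inl_inj A B : injective (@inl A B). Proof. by move=> x y []. Qed.
Let inr_inj A B : injective (@inr A B). Proof. by move=> x y []. Qed.

Fact sum_line_wf l : l \in sum_undrawn -> (1 <= #|sum_border l| <= 2)%N.
Proof.
case/setUP => /imsetP[x /line_wf xG ->] /=.
  by rewrite card_imset //; apply: inl_inj.
by rewrite card_imset //; apply: inr_inj.
Qed.

Fact sum_box_wf b :
  (#|[set l in sum_undrawn | b \in sum_border l]| <= 4)%N.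
Proof.
case: b => b; apply: leq_trans (box_wf b).
  rewrite -[leqRHS](card_imset _ (@inl_inj _ (line H))).
  apply/subset_leq_card/subsetP => l; rewrite inE => /andP[].
  case/setUP => /imsetP[x xG ->] /imsetP[y yx] // [->].
  by apply: imset_f; rewrite inE xG.
rewrite -[leqRHS](card_imset _ (@inr_inj (line G) _)).
apply/subset_leq_card/subsetP => l; rewrite inE => /andP[].
case/setUP => /imsetP[x xH ->] /imsetP[y yx] // [->].
by apply: imset_f; rewrite inE xH.
Qed.

Definition sum_position : position := Position sum_line_wf sum_box_wf.

End Sum.

(* c_1 + ... + c_n, with the empty position (the 0-chain) as last summand. *)
Definition chains (cs : seq nat) : position :=
  foldr (fun c G => sum_position (chain c) G) (chain 0) cs.

(* The controlled value of [chains cs]; meaningful for [cs] non-empty with all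
   lengths at least 3. The subtractions are in [int]. *)
Definition controlled_value (cs : seq nat) : int :=
  4 + \sum_(c <- cs) (c%:Z - 4).

(* Main.v *)
Require Import Defs.
From mathcomp Require Import all_boot all_order all_algebra.
From mathcomp Require Import zify.
Import Order.TTheory GRing.Theory Num.Theory.
Local Open Scope ring_scope.

Set Implicit Arguments.
Unset Strict Implicit.
Unset Printing Implicit Defensive.
(* Play on a disjoint union of chains only removes lines, so every position met
   is a set U of lines of the initial one. Call a chain of U intact if all its
   lines are undrawn and broken otherwise, let x be the value of the intact
   part and t the number of unclaimed boxes in broken chains. Then
     min(x, 4 - x) - t <= v(U) <= x - t,
   the upper bound by taking everything. Just after an intact chain has been
   opened, at one of its ends both last lines are undrawn, and the mover can
   take all but two boxes there and give these away, so v(U) <= 4 - x - t too.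
   Hence for a union G of intact chains
     v(G) = min over chains n of G of n + max(-v(G - n), v(G - n) - 4),
   from which the formulas follow by induction: the minimum is attained by
   opening a 3-chain if there is one, and by any chain otherwise. *)

(** * Positions given by sets of remaining lines *)

Section Restrict.
Variable G : position.
Implicit Types (U W : {set line G}) (l m : line G) (b : box G).

Fact restrict_line_wf U l :
  l \in U :&: undrawn G -> (1 <= #|border l| <= 2)%N.
Proof. by case/setIP => _ /line_wf. Qed.

Fact restrict_box_wf U b :
  (#|[set l in U :&: undrawn G | b \in border l]| <= 4)%N.
Proof.
apply: leq_trans (box_wf b); apply/subset_leq_card/subsetP => l.
by rewrite !inE => /andP[/andP[_ ->] ->].
Qed.

(** Intersecting with [undrawn G] yields a position for every [U], so no inclusion proof enters the
    term; all these positions share the types of [G]. *)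
Definition restrict U : position :=
  Position (@restrict_line_wf U) (@restrict_box_wf U).

Definition rvalue U : int := value (restrict U).

Definition boxes_left U : {set box G} := unclaimed (restrict U).

Lemma boxes_leftP U b : U \subset undrawn G ->
  reflect (exists2 l, l \in U & b \in border l) (b \in boxes_left U).
Proof.
move=> /subsetP sU; rewrite inE; apply: (iffP existsP) => [[l]|[l lU bl]].
  by rewrite inE => /andP[/andP[lU _] bl]; exists l.
by exists l; rewrite inE lU sU.
Qed.

Lemma boxes_leftS U W : U \subset W -> boxes_left U \subset boxes_left W.
Proof.
move=> /subsetP sUW; apply/subsetP => b; rewrite !inE => /existsP[l].
rewrite inE -andbA => /and3P[lU lG bl]; apply/existsP; exists l.
by rewrite inE sUW ?lG.
Qed.

Definition nleft U : int := #|boxes_left U|%:Z.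

Lemma nleftS U W : U \subset W -> nleft U <= nleft W.
Proof. by move/boxes_leftS/subset_leq_card; rewrite /nleft; lia. Qed.

End Restrict.

(** Equal sets of lines may come with different well-formedness proofs, so the two records need not
    be equal; the value never looks at these proofs. *)
Lemma value_ext (B L : finType) (bd : L -> {set B}) (U W : {set L})
    (Ul : forall l, l \in U -> (1 <= #|bd l| <= 2)%N)
    (Ub : forall b, (#|[set l in U | b \in bd l]| <= 4)%N)
    (Wl : forall l, l \in W -> (1 <= #|bd l| <= 2)%N)
    (Wb : forall b, (#|[set l in W | b \in bd l]| <= 4)%N) :
  U = W -> value (Position Ul Ub) = value (Position Wl Wb).
Proof.
move=> eUW; case: W / eUW Wl Wb => Wl Wb; rewrite /value /=.
move: #|U| => k; elim: k U Ul Ub Wl Wb => //= k IHk U Ul Ub Wl Wb.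
have scoreE m :
    move_score m (value_rec k (draw (m : line (Position Ul Ub))))
  = move_score m (value_rec k (draw (m : line (Position Wl Wb)))).
  by congr (move_score _ _); apply: IHk.
case: pickP => // m0 _; rewrite scoreE.
by apply: eq_bigr => m _; rewrite scoreE.
Qed.

(** * Moves, runs of captures and isolated lines *)

Section RestrictMoves.
Variable G : position.
Implicit Types (U W : {set line G}) (l m : line G).

Lemma value_draw_restrict U m :
  value (draw (m : line (restrict U))) = rvalue (U :\ m).
Proof. by apply: value_ext; apply/setP => l; rewrite !inE andbA. Qed.

Lemma captures_restrict U m :
  (captures (m : line (restrict U)))%:Z = nleft U - nleft (U :\ m).
Proof.
have -> : captures (m : line (restrict U))
    = #|boxes_left U :\: boxes_left (U :\ m)|.
  rewrite /captures; congr #|pred_of_set (_ :\: _)|.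
  by apply/setP => b; rewrite !inE; apply: eq_existsb => l; rewrite !inE andbA.
have sU := boxes_leftS (subD1set U m).
by have := subset_leq_card sU; rewrite cardsDS // /nleft; lia.
Qed.

Lemma value_after_restrict U m :
  value_after (m : line (restrict U)) =
    if nleft (U :\ m) < nleft U
    then rvalue (U :\ m) - (nleft U - nleft (U :\ m)) else - rvalue (U :\ m).
Proof.
rewrite /value_after /move_score value_draw_restrict.
have := captures_restrict U m; set c := captures _ => cE.
by rewrite -cE; congr (if _ then _ else _); lia.
Qed.

Lemma rvalue_capture U m : U \subset undrawn G -> m \in U ->
  nleft (U :\ m) < nleft U ->
  rvalue U <= rvalue (U :\ m) - (nleft U - nleft (U :\ m)).
Proof.
move=> sU mU lt_m; have := @value_le (restrict U) m.
by rewrite value_after_restrict lt_m; apply; rewrite inE mU (subsetP sU).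
Qed.

Lemma rvalue_pass U m : U \subset undrawn G -> m \in U ->
  nleft (U :\ m) = nleft U -> rvalue U <= - rvalue (U :\ m).
Proof.
move=> sU mU eq_m; have := @value_le (restrict U) m.
by rewrite value_after_restrict eq_m ltxx; apply; rewrite inE mU (subsetP sU).
Qed.

Lemma rvalue_attained U : U \subset undrawn G -> U != set0 ->
  exists2 m, m \in U &
    (nleft (U :\ m) < nleft U /\
      rvalue U = rvalue (U :\ m) - (nleft U - nleft (U :\ m))) \/
    (nleft (U :\ m) = nleft U /\ rvalue U = - rvalue (U :\ m)).
Proof.
move=> sU U0; have [|m] := @value_attained (restrict U).
  by rewrite /= (setIidPl sU).
rewrite /= (setIidPl sU) => mU; rewrite value_after_restrict => vE.
exists m => //; have := nleftS (subD1set U m); move: vE.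
by rewrite -/(rvalue U); case: ltP => ? ? ?; [left|right]; split=> //; lia.
Qed.

Lemma rvalue0 : rvalue (set0 : {set line G}) = 0.
Proof. by apply: value_no_line; rewrite /= set0I. Qed.

Lemma rvalue_setT : rvalue (undrawn G) = value G.
Proof. by case: G => B L bd U Ul Ub; apply: value_ext; rewrite setIid. Qed.

(** While lines outside [K] remain, one of them captures, so the mover keeps the turn down to [K]
    and is still to move there. *)
Lemma rvalue_capture_all U (K : {set line G}) :
  U \subset undrawn G -> K \subset U ->
  (forall W, K \proper W -> W \subset U ->
     exists2 m, m \in W :\: K & nleft (W :\ m) < nleft W) ->
  rvalue U <= rvalue K - (nleft U - nleft K).
Proof.
elim: {U}#|U| {-2}U (erefl #|U|) => [|n IHn] U cU sU sKU capt.
  have U0 : U = set0 by apply/eqP; rewrite -cards_eq0 cU.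
  by move: sKU; rewrite U0 subset0 => /eqP->; lia.
have [KU|] := boolP (K \proper U); last first.
  rewrite properE sKU negbK => sUK.
  have -> : K = U by apply/eqP; rewrite eqEsubset sKU.
  by lia.
have [m /setDP[mU mK] lt_m] := capt U KU (subxx _).
have sm := subD1set U m.
have := rvalue_capture sU mU lt_m.
have : rvalue (U :\ m) <= rvalue K - (nleft (U :\ m) - nleft K).
  apply: IHn => [|||W KW sW].
  - by have := cardsD1 m U; rewrite mU; lia.
  - exact: subset_trans sU.
  - by rewrite subsetD1 sKU.
  - by apply: capt => //; apply: subset_trans sm.
lia.
Qed.

Definition isolated U p :=
  forall l, l \in U -> l != p -> [disjoint border l & border p].

Lemma nleft_isolated U p : U \subset undrawn G -> p \in U -> isolated U p ->
  nleft U = nleft (U :\ p) + #|border p|%:Z.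
Proof.
move=> sU pU isoU; have sUp := subset_trans (subD1set U p) sU.
have -> : nleft U = #|boxes_left (U :\ p) :|: border p|%:Z.
  congr (#|pred_of_set _|%:Z); apply/setP => b; rewrite in_setU.
  apply/(boxes_leftP _ sU)/orP => [[l lU bl]|[/(boxes_leftP _ sUp)[l]|bp]].
  - have [elp|lp] := eqVneq l p; first by right; rewrite -elp.
    by left; apply/(boxes_leftP _ sUp); exists l; rewrite ?inE ?lp.
  - by case/setD1P => _ lU bl; exists l.
  - by exists p.
rewrite cardsU; have -> : boxes_left (U :\ p) :&: border p = set0.
  apply/setP => b; rewrite !in_set0 in_setI; apply/andP => -[].
  case/(boxes_leftP _ sUp) => l /setD1P[lp lU] bl bp.
  by have /pred0P/(_ b) := isoU l lU lp; rewrite /= bl bp.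
by rewrite cards0 subn0.
Qed.

(** Drawing [p] at once is optimal: it captures the same boxes whenever it is drawn, so any other
    first move can be postponed until after [p]. *)
Lemma rvalue_isolated U p : U \subset undrawn G -> p \in U -> isolated U p ->
  rvalue U = rvalue (U :\ p) - #|border p|%:Z.
Proof.
elim: {U}#|U| {-2}U (erefl #|U|) => [|n IHn] U cU sU pU isoU.
  by move: pU; rewrite (cards0_eq cU) inE.
have p_gt0 : (0 < #|border p|)%N.
  by have /andP[] := line_wf (subsetP sU _ pU).
have le_p W : W \subset U -> p \in W ->
    rvalue W <= rvalue (W :\ p) - #|border p|%:Z.
  move=> sWU pW; have sW := subset_trans sWU sU.
  have nW : nleft W = nleft (W :\ p) + #|border p|%:Z.
    by apply: nleft_isolated => // l lW; apply/isoU/(subsetP sWU).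
  by have := rvalue_capture sW pW; rewrite nW; lia.
apply/eqP; rewrite eq_le le_p //=.
have nU := nleft_isolated sU pU isoU.
have U0 : U != set0 by apply/set0Pn; exists p.
have [m mU [[lt_m ->]|[eq_m ->]]] := rvalue_attained sU U0;
  have [emp|mp] := eqVneq m p; try by move: emp => ?; subst m; lia.
all: have sUm := subset_trans (subD1set U m) sU.
all: have sUp := subset_trans (subD1set U p) sU.
all: have isoUm : isolated (U :\ m) p by move=> l /setD1P[_ /isoU].
all: have pUm : p \in U :\ m by rewrite !inE eq_sym mp.
all: have mUp : m \in U :\ p by rewrite !inE mp.
all: have mpC : U :\ m :\ p = U :\ p :\ m by rewrite !setDDl setUC.
all: have := nleft_isolated sUm pUm isoUm; rewrite mpC => nUm.
(* A capturing [m] commutes with [p]: by induction [p] may be drawn right after it, hence also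
   before it. *)
- have := IHn (U :\ m) _ sUm pUm isoUm; rewrite mpC => ->.
    by have := rvalue_capture sUp mUp; lia.
  by have := cardsD1 m U; rewrite mU; lia.
(* A move [m] without capture lets the opponent take the boxes of [p]. *)
- have := le_p _ (subD1set U m) pUm; rewrite mpC.
  by have := rvalue_pass sUp mUp; lia.
Qed.

End RestrictMoves.

(* A code is the index of a chain in [cs] and a position along that chain. *)
Record chain_coding (cs : seq nat) (G : position) (lcode : line G -> nat * nat)
    (bcode : box G -> nat * nat) : Prop := ChainCoding {
  lcode_inj : injective lcode;
  lcode_bound l : l \in undrawn G ->
    ((lcode l).1 < size cs)%N && ((lcode l).2 <= nth 0 cs (lcode l).1)%N;
  lcode_onto i j : (i < size cs)%N -> (j <= nth 0 cs i)%N ->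
    exists2 l, l \in undrawn G & lcode l = (i, j);
  bcode_bound b : ((bcode b).2 < nth 0 cs (bcode b).1)%N;
  bcode_onto i j : (i < size cs)%N -> (j < nth 0 cs i)%N ->
    exists b, bcode b = (i, j);
  bcode_card i : (i < size cs)%N ->
    #|[set b | (bcode b).1 == i]| = nth 0%N cs i;
  in_border l b : (b \in border l) = ((bcode b).1 == (lcode l).1) &&
    (((lcode l).2 == (bcode b).2) || ((lcode l).2 == (bcode b).2.+1))
}.

(** * Lines, boxes and captures in a coded sum of chains *)

Section Coded.
Variables (cs : seq nat) (G : position).
Variables (lcode : line G -> nat * nat) (bcode : box G -> nat * nat).
Hypothesis coding : chain_coding cs lcode bcode.
Hypothesis cs_ge3 : forall c, c \in cs -> (3 <= c)%N.

Local Notation idx l := (lcode l).1.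
Local Notation pos l := (lcode l).2.
Local Notation len := (nth 0%N cs).
Implicit Types (U W : {set line G}) (l m p q : line G) (b : box G) (i j : nat).

Lemma len_ge3 i : (i < size cs)%N -> (3 <= len i)%N.
Proof. by move=> i_lt; apply/cs_ge3/mem_nth. Qed.

Lemma idx_lt l : l \in undrawn G -> (idx l < size cs)%N.
Proof. by case/(lcode_bound coding)/andP. Qed.

Lemma pos_le l : l \in undrawn G -> (pos l <= len (idx l))%N.
Proof. by case/(lcode_bound coding)/andP. Qed.

Lemma eq_line l m : idx l = idx m -> pos l = pos m -> l = m.
Proof.
move=> ei ej; apply: (lcode_inj coding).
by rewrite [LHS]surjective_pairing ei ej -surjective_pairing.
Qed.

Lemma idx_border l b : b \in border l -> (bcode b).1 = idx l.
Proof. by rewrite (in_border coding) => /andP[/eqP]. Qed.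

Lemma idx_shared l m b : b \in border l -> b \in border m -> idx l = idx m.
Proof. by move=> /idx_border <- /idx_border. Qed.

Lemma disjoint_border l m : idx l != idx m -> [disjoint border l & border m].
Proof.
move=> lm; apply/pred0P => b /=; apply/andP => -[bl bm].
by rewrite (idx_shared bl bm) eqxx in lm.
Qed.

Lemma nleft_lt U m b : U \subset undrawn G -> m \in U -> b \in border m ->
  (forall l, l \in U -> l != m -> b \notin border l) ->
  nleft (U :\ m) < nleft U.
Proof.
move=> sU mU bm only_m; have sUm := subset_trans (subD1set U m) sU.
rewrite /nleft ltz_nat; apply/proper_card/properP; split.
  exact/boxes_leftS/subD1set.
exists b; first by apply/boxes_leftP => //; exists m.
apply/(boxes_leftP _ sUm) => -[l /setD1P[lm lU] bl].
by have := only_m l lU lm; rewrite bl.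
Qed.

(** Consecutive lines share a box, numbered by the smaller position, that no other line borders;
    with [m] drawn, [l] is its last line. *)
Lemma capture_next_to_drawn U l m : U \subset undrawn G -> l \in U ->
  m \in undrawn G -> m \notin U -> idx l = idx m ->
  pos l = (pos m).+1 \/ pos m = (pos l).+1 -> nleft (U :\ l) < nleft U.
Proof.
move=> sU lU mG mU elm adj; have lG := subsetP sU _ lU.
have j_lt : (minn (pos l) (pos m) < len (idx l))%N.
  by have := pos_le lG; have := pos_le mG; rewrite -elm; lia.
have [b bE] := bcode_onto coding (idx_lt lG) j_lt.
apply: (nleft_lt (b := b)) => // [|x xU xl].
  by rewrite (in_border coding) bE /= eqxx /=; lia.
rewrite (in_border coding) bE /=; apply/negP => /andP[/eqP ei ej].
have [xl' | xm'] : pos x = pos l \/ pos x = pos m by lia.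
  by case/eqP: xl; apply: eq_line; rewrite -?ei.
by case/negP: mU; rewrite -(eq_line _ xm') // -ei.
Qed.

(** Walking from [l] towards the drawn line [m], the last undrawn line before the first drawn one
    captures. The bounds on [pos x] later keep [x] away from two reserved lines. *)
Lemma capture_between U l m : U \subset undrawn G -> l \in U ->
  m \in undrawn G -> m \notin U -> idx l = idx m ->
  exists x, [/\ x \in U, idx x = idx l,
    (minn (pos l) (pos m) <= pos x <= maxn (pos l) (pos m))%N &
    nleft (U :\ x) < nleft U].
Proof.
move=> sU lU mG mU elm; have [d] := ubnP (`|pos l - pos m|)%N.
elim: d => // d IHd in l lU elm *; rewrite ltnS => le_d.
have lG := subsetP sU _ lU.
have [eqp|neqp] := eqVneq (pos l) (pos m).
  by case/negP: mU; rewrite -(eq_line elm eqp).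
(* [j] is the position one step from [l] towards [m]. *)
have [j jP] : exists j, j = (pos l).+1 /\ (j <= pos m)%N \/
    pos l = j.+1 /\ (pos m <= j)%N.
  case: (ltnP (pos l) (pos m)) => [lt_lm|le_ml].
    by exists (pos l).+1; left.
  by exists (pos l).-1; right; move: neqp le_ml; lia.
have j_le : (j <= len (idx l))%N.
  by have := pos_le lG; have := pos_le mG; rewrite -elm; move: jP; lia.
have [x xG xE] := lcode_onto coding (idx_lt lG) j_le.
have jE : pos x = j by rewrite xE.
have [xU|xU] := boolP (x \in U); last first.
  exists l; split=> //; first by lia.
  apply: (capture_next_to_drawn sU lU xG xU); first by rewrite xE.
  by rewrite jE; move: jP; lia.
have [||y [yU yi yj lt_y]] := IHd x xU.
- by rewrite xE.
- by rewrite jE; move: jP le_d; lia.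
exists y; split=> //; first by rewrite yi xE.
by move: yj jP; rewrite jE; lia.
Qed.

(** * Intact and broken chains *)

Definition chain_lines i : {set line G} := [set l in undrawn G | idx l == i].

Definition intact U : {set line G} :=
  [set l in U | chain_lines (idx l) \subset U].

Lemma intactS U : intact U \subset U.
Proof. by apply/subsetP => l; rewrite inE => /andP[]. Qed.

Lemma mem_intact_idx U l m : m \in U -> idx l = idx m ->
  l \in intact U -> m \in intact U.
Proof. by rewrite !inE => -> -> /andP[]. Qed.

Lemma broken_chain U l : U \subset undrawn G -> l \in U -> l \notin intact U ->
  exists2 m, m \in undrawn G & m \notin U /\ idx l = idx m.
Proof.
move=> sU lU; rewrite inE lU /= => /subsetPn[m].
by rewrite inE => /andP[mG /eqP ml] mU; exists m.
Qed.

Lemma intactD1 U m : U \subset undrawn G -> m \in U ->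
  intact (U :\ m) = intact U :\: chain_lines (idx m).
Proof.
move=> sU mU; have mG := subsetP sU _ mU.
apply/setP => l; rewrite !inE.
have [lm|lm] := eqVneq (idx l) (idx m).
  have -> : chain_lines (idx l) \subset U :\ m = false.
    apply/negbTE/subsetPn; exists m; first by rewrite inE mG lm eqxx.
    by rewrite !inE eqxx.
  rewrite andbF andbT; have [lU|] := boolP (l \in U); last by rewrite andbF.
  by rewrite (subsetP sU _ lU).
rewrite andbF /=; have -> : l != m by apply: contraNneq lm => ->.
have [lU|//] := boolP (l \in U); rewrite /= subsetD1.
by rewrite inE mG eq_sym (negbTE lm) andbT.
Qed.

Lemma intact_id U : intact (intact U) = intact U.
Proof.
apply/setP => l; rewrite [LHS]inE; have [lU|//] := boolP (l \in intact U).
apply/subsetP => m; move: lU; rewrite !inE => /andP[lU sl] /andP[mG /eqP ml].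
by rewrite ml sl (subsetP sl) // inE mG ml eqxx.
Qed.

(** A broken chain has a drawn line, which stays drawn in every later [W], so [capture_between]
    supplies captures until only intact chains remain. *)
Lemma rvalue_take_all U : U \subset undrawn G ->
  rvalue U <= rvalue (intact U) - (nleft U - nleft (intact U)).
Proof.
move=> sU; apply: rvalue_capture_all => // [|W]; first exact: intactS.
case/properP=> _ [l lW lU] sWU; have sW := subset_trans sWU sU.
have [m mG [mU lm]] := broken_chain sU (subsetP sWU _ lW) lU.
have mW : m \notin W by apply: contra mU => /(subsetP sWU).
have [x [xW xl _ lt_x]] := capture_between sW lW mG mW lm.
exists x => //; rewrite inE xW andbT; apply: contra lU.
exact: mem_intact_idx (subsetP sWU _ lW) xl.
Qed.

(** [q] is an outermost line of its chain and [p] its neighbour. The box at [q] also borders [p], so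
    drawing [q] while [p] is undrawn claims nothing. *)
Definition end_pair p q := idx p = idx q /\
  (pos q = 0%N /\ pos p = 1%N \/ pos q = len (idx q) /\ (pos p).+1 = pos q).

Lemma end_pair_border p q : end_pair p q -> border q \subset border p.
Proof.
case=> epq adj; apply/subsetP => b; rewrite !(in_border coding) epq.
move=> /andP[/eqP bq ej]; have := bcode_bound coding b; rewrite bq eqxx /=.
by move: adj ej; lia.
Qed.

(* The mover takes every box of the broken chains except the two bordering [p],
   then gives these two away by drawing [q]. *)
Lemma rvalue_double_deal U p q : U \subset undrawn G -> p \in U -> q \in U ->
  p \notin intact U -> end_pair p q ->
  rvalue U <= 4 - rvalue (intact U) - (nleft U - nleft (intact U)).
Proof.
move=> sU pU qU pI pq; set U0 := intact U; pose K := q |: (p |: U0).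
have sU0 : U0 \subset U by apply: intactS.
have [epq pos_pq] := pq.
have qI : q \notin U0 by apply: contra pI; apply: mem_intact_idx.
have qp : q != p by apply/eqP => e; move: pos_pq; rewrite e; lia.
have sKU : K \subset U by rewrite !subUset !sub1set pU qU.
have sK := subset_trans sKU sU.
have KqE : K :\ q = p |: U0 by rewrite setU1K // in_setU1 negb_or qp.
have sKq : p |: U0 \subset undrawn G.
  by rewrite -KqE; apply: subset_trans sK; apply: subD1set.
have pKq : p \in p |: U0 by rewrite setU11.
have KpE : (p |: U0) :\ p = U0 by rewrite setU1K.
(* With [q] drawn, [p] is the only line left in a broken chain, so taking its boxes first is optimal
   for the opponent. *)
have iso_p : isolated (p |: U0) p.
  move=> l /setU1P[->|lU0 lp]; first by rewrite eqxx.
  by apply: disjoint_border; apply: contra pI => /eqP /mem_intact_idx; apply.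
have := nleft_isolated sKq pKq iso_p; have := rvalue_isolated sKq pKq iso_p.
rewrite KpE => v_p n_p.
have n_q : nleft (K :\ q) = nleft K.
  apply/eqP; rewrite eq_le nleftS ?subD1set //= /nleft lez_nat.
  apply/subset_leq_card/subsetP => b /(boxes_leftP _ sK)[l lK bl].
  rewrite KqE; apply/(boxes_leftP _ sKq).
  move: lK; rewrite in_setU1 => /predU1P[lq|lK]; last by exists l.
  by exists p => //; apply: (subsetP (end_pair_border pq)); rewrite -lq.
have := rvalue_pass sK (setU11 q _) n_q; move: n_q; rewrite KqE => n_q.
have : rvalue U <= rvalue K - (nleft U - nleft K).
  apply: rvalue_capture_all => // W /properP[sKW [l lW lK]] sWU.
  have sW := subset_trans sWU sU.
  have lU := subsetP sWU _ lW.
  have [lq lp lU0] : [/\ l != q, l != p & l \notin U0].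
    by move: lK; rewrite !in_setU1 !negb_or => /and3P.
  have [m mG [mU lm]] := broken_chain sU lU lU0.
  have mW : m \notin W by apply: contra mU => /(subsetP sWU).
  have [x [xW xl xb lt_x]] := capture_between sW lW mG mW lm.
  exists x => //; rewrite inE xW andbT !in_setU1 !negb_or; apply/and3P.
  have lG := subsetP sU _ lU.
  have neqpos u v : idx u = idx v -> u != v -> pos u != pos v.
    by move=> ei; apply: contraNneq => /(eq_line ei) ->.
  have mq : m != q by apply: contraNneq mU => ->.
  have mp : m != p by apply: contraNneq mU => ->.
  have l_le := pos_le lG; have m_le := pos_le mG.
  (* [x] lies between [l] and [m], neither of which is [p] or [q]; as [p] and [q] occupy the last
     two positions at one end, [x] is neither of them. *)
  have far : idx x = idx q -> pos x != pos q /\ pos x != pos p.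
    move=> xq; have lqi : idx l = idx q by rewrite -xl.
    have := neqpos l q lqi lq; have := neqpos m q (etrans (esym lm) lqi) mq.
    have := neqpos l p (etrans lqi (esym epq)) lp.
    have := neqpos m p (etrans (esym lm) (etrans lqi (esym epq))) mp.
    move: pos_pq m_le l_le xb; rewrite -lm lqi.
    by clear; case=> -[-> ?]; lia.
  split.
  - by apply/eqP => e; rewrite e in far; have [] := far erefl; rewrite eqxx.
  - by apply/eqP => e; rewrite e in far; have [] := far epq; rewrite eqxx.
  - by apply: contra lU0; apply: mem_intact_idx lU xl.
(* Leaving the boxes of [p] to the opponent costs twice their number, hence at most 4. *)
have /andP[_] := line_wf (subsetP sU _ pU).
by move: v_p n_p n_q; clear; lia.
Qed.

(** * Opening an intact chain, and the two bounds *)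

(** A chain of length at least 3 has at least four lines, so the pairs at its two ends are disjoint
    and [m] meets at most one of them. *)
Lemma intact_end_pair U m : U \subset undrawn G -> m \in intact U ->
  exists p q, [/\ p \in U :\ m, q \in U :\ m, idx p = idx m & end_pair p q].
Proof.
move=> sU; rewrite inE => /andP[mU sm]; have mG := subsetP sU _ mU.
have i_lt := idx_lt mG; have n3 := len_ge3 i_lt.
have line_at j : (j <= len (idx m))%N -> j != pos m ->
    exists l, [/\ l \in U :\ m, idx l = idx m & pos l = j].
  move=> j_le jm; have [l lG lE] := lcode_onto coding i_lt j_le.
  exists l; rewrite lE; split=> //; rewrite !inE.
  rewrite (subsetP sm) ?inE ?lG ?lE ?eqxx // andbT.
  by apply: contraNneq jm => <-; rewrite lE.
have [m_small|m_big] := leqP (pos m).+2 (len (idx m)).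
  have [||p [pU pi pj]] := line_at (len (idx m)).-1; try by lia.
  have [||q [qU qi qj]] := line_at (len (idx m)); try by lia.
  exists p, q; split=> //; split; first by rewrite pi.
  by right; rewrite qi pj qj; lia.
have [||p [pU pi pj]] := line_at 1%N; try by lia.
have [||q [qU qi qj]] := line_at 0%N; try by lia.
by exists p, q; split=> //; split; [rewrite pi | left].
Qed.

(** Each box of an intact chain has two undrawn lines, hence keeps one when [m] is drawn. *)
Lemma nleft_intactD1 U m : U \subset undrawn G -> m \in intact U ->
  nleft (U :\ m) = nleft U.
Proof.
move=> sU; rewrite inE => /andP[mU sm]; have mG := subsetP sU _ mU.
have sUm := subset_trans (subD1set U m) sU.
apply/eqP; rewrite eq_le nleftS ?subD1set //= /nleft lez_nat.
apply/subset_leq_card/subsetP => b /(boxes_leftP _ sU)[l lU bl].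
apply/(boxes_leftP _ sUm).
have [lm|lm] := eqVneq l m; last by exists l; rewrite // !inE lm.
move: bl; rewrite lm (in_border coding) => /andP[/eqP bi bj].
(* The position of the other line of [b]. *)
pose j := if pos m == (bcode b).2 then (bcode b).2.+1 else (bcode b).2.
have j_le : (j <= len (idx m))%N.
  by have := bcode_bound coding b; rewrite bi /j; case: eqP; lia.
have [x xG xE] := lcode_onto coding (idx_lt mG) j_le; exists x.
  rewrite !inE (subsetP sm) ?inE ?xG ?xE ?eqxx // andbT.
  apply/eqP => xm; have := congr1 snd xE; rewrite xm /= /j.
  by case: eqP; lia.
rewrite (in_border coding) xE bi eqxx /= /j.
by case: ifP; rewrite eqxx ?orbT.
Qed.

(** As [m] captures nothing, a box [b] at [m] has a second undrawn line [l], and the two lines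
    together also border a box next to [b]. [rvalue_ge] needs these 2 boxes when a move in a broken
    chain passes the turn. *)
Lemma nleft_broken U m : U \subset undrawn G -> m \in U -> m \notin intact U ->
  nleft (U :\ m) = nleft U -> nleft (intact U) + 2 <= nleft U.
Proof.
move=> sU mU mI eq_m; have mG := subsetP sU _ mU.
have sUm := subset_trans (subD1set U m) sU.
have sI := subset_trans (intactS U) sU.
have /andP[/card_gt0P[b bm] _] := line_wf mG.
have [l [lU lm bl]] : exists l, [/\ l \in U, l != m & b \in border l].
  have [/existsP[l /and3P[]]|none] :=
      boolP [exists l, [&& l \in U, l != m & b \in border l]].
    by exists l.
  have := @nleft_lt U m b sU mU bm; rewrite eq_m ltxx => H.
  case: notF; apply: H => l lU lm; apply: contra none => bl.
  by apply/existsP; exists l; rewrite lU lm.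
have i_lt := idx_lt mG; have n3 := len_ge3 i_lt.
have elm := idx_shared bl bm.
have poslm : pos l != pos m.
  by apply: contraNneq lm => /(eq_line elm) ->.
(* The previous box or, for the end box 0, box 1. *)
pose j := if (bcode b).2 is k.+1 then k else 1%N.
have j_lt : (j < len (idx m))%N.
  have := bcode_bound coding b; rewrite (idx_border bm) /j; move: n3.
  by clear; case: (bcode b).2 => [|k]; lia.
have [b' b'E] := bcode_onto coding i_lt j_lt.
have b'b : b' != b.
  apply/eqP => e; have := congr1 snd b'E; rewrite e /= /j.
  by clear; case: (bcode b).2 => [|k]; lia.
have b'left : b' \in boxes_left U.
  have : (b' \in border l) || (b' \in border m).
    move: bl bm; rewrite !(in_border coding) b'E /= elm => /andP[_ blj].
    case/andP=> _ bmj; rewrite eqxx /=; move: blj bmj poslm; rewrite /j.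
    by clear; case: (bcode b).2 => [|k]; lia.
  by case/orP => b'in; apply/(boxes_leftP _ sU); [exists l|exists m].
have bleft : b \in boxes_left U by apply/(boxes_leftP _ sU); exists m.
have notI x : (bcode x).1 = idx m -> x \notin boxes_left (intact U).
  move=> xi; apply/negP => /(boxes_leftP _ sI)[y yI /idx_border].
  by rewrite xi => /esym e; case/negP: mI; apply: mem_intact_idx yI.
have := subset_leq_card (boxes_leftS (intactS U)).
have : (#|[set b'; b]| <= #|boxes_left U :\: boxes_left (intact U)|)%N.
  apply/subset_leq_card/subsetP => x; rewrite !in_set2 in_setD.
  case/orP => /eqP->; rewrite ?b'left ?bleft andbT notI ?b'E //.
  exact: idx_border bm.
by rewrite cards2 b'b cardsDS ?boxes_leftS ?intactS // /nleft; clear; lia.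
Qed.

(** Once [m] opens its chain, the next player can take everything outside [K] and then move in [K],
    or give two boxes away and make the opponent move there. *)
Lemma rvalue_opened_le U m : U \subset undrawn G -> m \in intact U ->
  forall K, K = intact U :\: chain_lines (idx m) ->
  rvalue (U :\ m) <= Num.min (rvalue K) (4 - rvalue K) - (nleft U - nleft K).
Proof.
move=> sU mI K defK; have mU := subsetP (intactS U) _ mI.
have sUm := subset_trans (subD1set U m) sU.
have [p [q [pU qU pm pq]]] := intact_end_pair sU mI.
have KE : intact (U :\ m) = K by rewrite defK; apply: intactD1.
have pI : p \notin intact (U :\ m).
  by rewrite KE defK !inE pm eqxx andbT (subsetP sU) ?(setD1P pU).2.
have := rvalue_take_all sUm; have := rvalue_double_deal sUm pU qU pI pq.
by rewrite KE (nleft_intactD1 sU mI); lia.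
Qed.

Lemma rvalue_ge U : U \subset undrawn G ->
  Num.min (rvalue (intact U)) (4 - rvalue (intact U))
    - (nleft U - nleft (intact U)) <= rvalue U.
Proof.
have [d] := ubnP #|U|; elim: d => // d IHd in U *; rewrite ltnS => le_d sU.
have [->|U0] := eqVneq U set0.
  have -> : intact set0 = set0 by apply/setP => l; rewrite !inE.
  by rewrite rvalue0; lia.
have [m mU vU] := rvalue_attained sU U0.
have sI := subset_trans (intactS U) sU.
have sUm := subset_trans (subD1set U m) sU.
have IE := intactD1 sU mU.
have card_m W : W \subset U -> m \in W -> (#|W :\ m| < d)%N.
  by move=> /subset_leq_card le_W mW; move: le_W; rewrite (cardsD1 m W) mW; lia.
have [mI|mI] := boolP (m \in intact U).
  (* An opening. The same opening in [intact U], where induction bounds the outcome, gives [rvalue U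
     >= rvalue (intact U) + (nleft U - nleft (intact U))]. *)
  case: vU => -[]; first by rewrite nleft_intactD1 // ltxx.
  move=> eq_m ->; have := rvalue_opened_le sU mI erefl.
  have mII : m \in intact (intact U) by rewrite intact_id.
  have := rvalue_pass sI mI (nleft_intactD1 sI mII).
  have := IHd (intact U :\ m) (card_m _ (intactS U) mI)
    (subset_trans (subD1set _ m) sI).
  rewrite (intactD1 sI mI) intact_id (nleft_intactD1 sI mII).
  by have := nleftS (intactS U); lia.
have IE' : intact (U :\ m) = intact U.
  rewrite IE; apply/setDidPl/pred0P => l /=; apply/andP => -[lI].
  rewrite inE => /andP[_ /eqP lm]; case/negP: mI.
  exact: mem_intact_idx lI.
case: vU => -[eq_m ->].
  (* A capture in a broken chain leaves the intact part unchanged. *)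
  by have := IHd (U :\ m) (card_m _ (subxx U) mU) sUm; rewrite IE'; lia.
(* The turn passes. With [x] the value of the intact part and [t] the number of boxes outside it,
   the opponent can take all, so [rvalue U >= t - x]; since [t >= 2], this is at least
   [4 - x - t]. *)
have := rvalue_take_all sUm; rewrite IE' eq_m.
by have := nleft_broken sU mU mI eq_m; lia.
Qed.

(** * Removing whole chains, and the controlled value *)

Lemma intact_sub U m : intact U = U -> m \in U -> chain_lines (idx m) \subset U.
Proof. by move=> IU mU; move: (mU); rewrite -{1}IU inE => /andP[]. Qed.

Lemma intact_remove U i : U \subset undrawn G -> intact U = U ->
  intact (U :\: chain_lines i) = U :\: chain_lines i.
Proof.
move=> sU IU; apply/setP => l; rewrite [LHS]inE.
have [/setDP[lU li]|//] := boolP (l \in _); apply/subsetP => x.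
rewrite in_setD => /[dup] xl /(subsetP (intact_sub IU lU)) ->; rewrite andbT.
by move: li xl; rewrite !inE (subsetP sU _ lU) => + /andP[-> /eqP->].
Qed.

Lemma nleft_remove U m : U \subset undrawn G -> intact U = U -> m \in U ->
  nleft U = nleft (U :\: chain_lines (idx m)) + (len (idx m))%:Z.
Proof.
move=> sU IU mU; set K := U :\: _.
have mG := subsetP sU _ mU; have i_lt := idx_lt mG.
have sK : K \subset undrawn G := subset_trans (subsetDl _ _) sU.
rewrite -(bcode_card coding i_lt) /nleft.
have -> : boxes_left U = boxes_left K :|: [set b | (bcode b).1 == idx m].
  apply/setP => b; rewrite in_setU [X in _ || X]inE.
  apply/(boxes_leftP _ sU)/orP => [[l lU bl]|[/(boxes_leftP _ sK)[l]|/eqP bi]].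
  - have [li|li] := eqVneq (idx l) (idx m).
      by right; rewrite (idx_border bl) li.
    left; apply/(boxes_leftP _ sK); exists l => //.
    by rewrite !inE lU (negbTE li) andbF.
  - by case/setDP => lU _ bl; exists l.
  have j_le : ((bcode b).2 <= len (idx m))%N.
    by have := bcode_bound coding b; rewrite bi; apply: ltnW.
  have [l lG lE] := lcode_onto coding i_lt j_le; exists l.
    by apply: (subsetP (intact_sub IU mU)); rewrite inE lG lE eqxx.
  by rewrite (in_border coding) lE bi !eqxx.
rewrite cardsU.
have -> : boxes_left K :&: [set b | (bcode b).1 == idx m] = set0.
  apply/setP => b; rewrite in_setI in_set0 [X in _ && X]inE; apply/andP => -[].
  case/(boxes_leftP _ sK) => l /setDP[lU li] /idx_border -> /eqP e.
  by move: li; rewrite inE e eqxx (subsetP sU).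
by rewrite cards0 subn0.
Qed.

(** On [set0] this formula gives 4 while [rvalue] is 0, so the induction treats the empty union
    separately. *)
Definition cvalue U : int :=
  4 + \sum_(i < size cs | chain_lines i \subset U) ((len i)%:Z - 4).

Lemma chain_lines_neq0 i : (i < size cs)%N -> chain_lines i != set0.
Proof.
move=> i_lt; have [l lG lE] := lcode_onto coding i_lt (leq0n _).
by apply/set0Pn; exists l; rewrite inE lG lE eqxx.
Qed.

Lemma cvalue_remove U m : U \subset undrawn G -> intact U = U -> m \in U ->
  cvalue U = cvalue (U :\: chain_lines (idx m)) + ((len (idx m))%:Z - 4).
Proof.
move=> sU IU mU; have i_lt := idx_lt (subsetP sU _ mU).
rewrite /cvalue (bigD1 (Ordinal i_lt)) /=; last exact: intact_sub.
rewrite [_ - 4 + _]addrC addrA; congr (_ + _ + _); apply: eq_bigl => i.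
rewrite subsetD; congr (_ && _); rewrite -(inj_eq val_inj) /=.
have [->|im] := eqVneq (i : nat) (idx m).
  by apply/esym/negbTE; rewrite -setI_eq0 setIid chain_lines_neq0.
apply/esym/pred0P => l /=; rewrite !inE; apply/andP => -[/andP[_ /eqP->]].
by rewrite (negbTE im) andbF.
Qed.

Lemma cvalue0 : cvalue set0 = 4.
Proof.
rewrite /cvalue big_pred0 ?addr0 // => i.
by rewrite subset0 (negbTE (chain_lines_neq0 (ltn_ord i))).
Qed.

(** * The recursion over opened chains and its solution *)

(** Drawing [m] passes the turn and leaves one broken chain, whose boxes are the term [len (idx m)];
    [rvalue_ge] limits what the opponent gains. *)
Lemma rvalue_open U m : U \subset undrawn G -> intact U = U -> m \in U ->
  let y := rvalue (U :\: chain_lines (idx m)) in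
  rvalue U <= Num.max (- y) (y - 4) + (len (idx m))%:Z.
Proof.
move=> sU IU mU; cbv zeta.
have sUm := subset_trans (subD1set U m) sU.
have mI : m \in intact U by rewrite IU.
have := rvalue_pass sU mU (nleft_intactD1 sU mI); have := rvalue_ge sUm.
rewrite intactD1 // IU (nleft_intactD1 sU mI) (nleft_remove sU IU mU).
by clear; lia.
Qed.

(** When all chains are intact every move is an opening, so by [rvalue_opened_le] an optimal move
    meets the bound of [rvalue_open]. *)
Lemma rvalue_open_attained U : U \subset undrawn G -> intact U = U ->
  U != set0 -> exists2 m, m \in U &
  let y := rvalue (U :\: chain_lines (idx m)) in
  rvalue U = Num.max (- y) (y - 4) + (len (idx m))%:Z.
Proof.
move=> sU IU U0; have [m mU vU] := rvalue_attained sU U0.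
exists m => //=; have mI : m \in intact U by rewrite IU.
have := rvalue_open sU IU mU; cbv zeta.
have := rvalue_opened_le sU mI erefl; rewrite IU (nleft_remove sU IU mU).
by case: vU; rewrite nleft_intactD1 // ?ltxx => -[//= _ ->]; clear; lia.
Qed.

(** The term [max (- y) (y - 4)] is at least [y - 4] and at least -2, and has the parity of [y].
    With lengths at least 3 this gives the lower bounds and the congruence from any optimal opening;
    the upper bounds depend on whether there is a 3-chain. *)
Lemma rvalue_cvalue U : U \subset undrawn G -> intact U = U -> U != set0 ->
  [/\ cvalue U <= rvalue U, 1 <= rvalue U,
      1 <= cvalue U -> rvalue U <= cvalue U,
      cvalue U <= 0 -> rvalue U <= 2 & (2 %| rvalue U - cvalue U)%Z].
Proof.
have [d] := ubnP #|U|; elim: d => // d IHd in U *.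
rewrite ltnS => le_d sU IU U0.
have IH m : m \in U -> let K := U :\: chain_lines (idx m) in K != set0 ->
  [/\ cvalue K <= rvalue K, 1 <= rvalue K,
      1 <= cvalue K -> rvalue K <= cvalue K,
      cvalue K <= 0 -> rvalue K <= 2 & (2 %| rvalue K - cvalue K)%Z].
  move=> mU K K0; have IK : intact K = K by apply: intact_remove.
  have sK : K \subset undrawn G := subset_trans (subsetDl _ _) sU.
  apply: IHd => //; apply: leq_trans le_d; apply/proper_card/properP.
  split; first exact: subsetDl.
  by exists m; rewrite // !inE (subsetP sU) // eqxx.
have len3 m : m \in U -> (3 <= len (idx m))%N.
  by move=> mU; apply/len_ge3/idx_lt/(subsetP sU).
have [m mU] := rvalue_open_attained sU IU U0; cbv zeta.
have := cvalue_remove sU IU mU; set K := U :\: _ => cU vU.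
have n3 := len3 m mU.
(* For a single chain [y = 0], so the value is its length. *)
have [K0|K0] := eqVneq K set0.
  move: vU cU; rewrite K0 rvalue0 cvalue0 => vU cU.
  by split; move: vU cU n3; clear; lia.
have := IH m mU K0; rewrite /= -/K => -[cK vK1 cK1 cK0 parK].
have cU_le : cvalue U <= rvalue U.
  by move: cU vU cK; clear; lia.
have vU1 : 1 <= rvalue U by move: vU n3; clear; lia.
have par : (2 %| rvalue U - cvalue U)%Z.
  by move: cU vU parK; clear; lia.
suff [] : (1 <= cvalue U -> rvalue U <= cvalue U) /\
    (cvalue U <= 0 -> rvalue U <= 2).
  by split.
(* Opening a 3-chain gives [rvalue U <= max (3 - y) (y - 1)], and induction on the rest controls
   [y]. *)
have [/existsP[x /andP[xU /eqP x3]]|no3] :=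
  boolP [exists x, (x \in U) && (len (idx x) == 3)].
  have := rvalue_open sU IU xU; have := cvalue_remove sU IU xU; cbv zeta.
  have [->|L0] := eqVneq (U :\: chain_lines (idx x)) set0.
    by rewrite rvalue0 cvalue0 x3; clear; lia.
  have [] := IH x xU L0; rewrite x3; clear; lia.
(* Without 3-chains the rest has controlled value at least 4, so [y] equals it and [y - 4] is the
   larger term. *)
have K4 : 4 <= cvalue K.
  rewrite /cvalue lerDl; apply: sumr_ge0 => i si.
  have /set0Pn[l li] := chain_lines_neq0 (ltn_ord i).
  have /setDP[lU _] := subsetP si _ li.
  move: li; rewrite inE => /andP[_ /eqP li].
  move/existsPn/(_ l): no3; rewrite lU li /=; have := len3 l lU; rewrite li.
  by clear; lia.
by move: cU vU K4 cK cK1; clear; lia.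
Qed.

Lemma value_coded : (1 <= size cs)%N ->
  [/\ controlled_value cs <= value G, 1 <= value G,
      1 <= controlled_value cs -> value G <= controlled_value cs,
      controlled_value cs <= 0 -> value G <= 2 &
      (2 %| value G - controlled_value cs)%Z].
Proof.
move=> cs_gt0; have I_T : intact (undrawn G) = undrawn G.
  apply/setP => l; rewrite [LHS]inE; have [lG|//] := boolP (l \in _).
  by apply/subsetP => x; rewrite inE => /andP[].
have -> : controlled_value cs = cvalue (undrawn G).
  rewrite /controlled_value /cvalue (big_nth 0%N) big_mkord; congr (_ + _).
  apply: eq_bigl => i; apply/esym/subsetP => l.
  by rewrite inE => /andP[].
rewrite -rvalue_setT; apply: rvalue_cvalue => //.
have [l lG _] := lcode_onto coding cs_gt0 (leq0n _).
by apply/set0Pn; exists l.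
Qed.

End Coded.

(** * The coding of [chains cs], and the conclusion *)

(** The empty summand ending [chains cs] still has one line in its type, coded with index [size cs];
    it is not undrawn, so [lcode_bound] does not concern it. *)
Fixpoint chains_lcode (cs : seq nat) : line (chains cs) -> nat * nat :=
  match cs return line (chains cs) -> nat * nat with
  | [::] => fun l => (0%N, nat_of_ord l)
  | c :: cs' => fun l => match l with
    | inl e => (0%N, nat_of_ord e)
    | inr l' => ((@chains_lcode cs' l').1.+1, (@chains_lcode cs' l').2)
    end
  end.

Fixpoint chains_bcode (cs : seq nat) : box (chains cs) -> nat * nat :=
  match cs return box (chains cs) -> nat * nat with
  | [::] => fun b => (0%N, nat_of_ord b)
  | c :: cs' => fun b => match b with
    | inl e => (0%N, nat_of_ord e)
    | inr b' => ((@chains_bcode cs' b').1.+1, (@chains_bcode cs' b').2)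
    end
  end.

Lemma mem_inl (A B : finType) (S : {set A}) (T : {set B}) x :
  ((inl x : A + B)%type \in inl @: S :|: inr @: T) = (x \in S).
Proof.
rewrite inE (mem_imset _ _ inl_inj).
by case: imsetP => [[]//|_]; rewrite orbF.
Qed.

Lemma mem_inr (A B : finType) (S : {set A}) (T : {set B}) x :
  ((inr x : A + B)%type \in inl @: S :|: inr @: T) = (x \in T).
Proof.
rewrite inE orbC (mem_imset _ _ inr_inj).
by case: imsetP => [[]//|_]; rewrite orbF.
Qed.

(** Positive lengths make every line of each listed chain undrawn, as [lcode_onto] requires: a
    0-chain has a line in its type but none undrawn. *)
Lemma chains_coding cs : (forall c, c \in cs -> (0 < c)%N) ->
  chain_coding cs (@chains_lcode cs) (@chains_bcode cs).
Proof.
elim: cs => [|c cs IHcs] cs_gt0.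
  split=> //= [l m [/val_inj]//|l|l []//].
  by rewrite inE.
have c_gt0 : (0 < c)%N by apply: cs_gt0; rewrite mem_head.
have [] := IHcs (fun x xcs => cs_gt0 x (mem_behead (s := c :: cs) xcs)).
move=> inj bd_l onto_l bd_b onto_b card_b bdE.
split=> /=.
- move=> [e|l] [e'|l'] //= [].
    by move/val_inj => ->.
  move=> e1 e2; congr inr; apply: inj; apply/eqP.
  by rewrite /eq_op /= e1 e2 !eqxx.
- case=> [e|l]; rewrite ?mem_inl ?mem_inr /=.
    by move=> _; rewrite -ltnS.
  by move/bd_l; rewrite ltnS.
- move=> [|i] j /= i_lt j_le.
    by exists (inl (inord j)); rewrite ?mem_inl ?inE //= inordK.
  have [l lG lE] := onto_l i j i_lt j_le.
  by exists (inr l); rewrite ?mem_inr //= lE.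
- by case=> [e|b] /=.
- move=> [|i] j /= i_lt j_lt; first by exists (inl (Ordinal j_lt)).
  by have [b bE] := onto_b i j i_lt j_lt; exists (inr b); rewrite /= bE.
- move=> [|i] /= i_lt.
    rewrite -[RHS](card_ord c) -cardsT.
    rewrite -[RHS](card_imset _ (@inl_inj _ (box (chains cs)))).
    apply: eq_card => -[e|b]; rewrite inE /=.
      by rewrite mem_imset ?inE //; apply: inl_inj.
    by apply/esym/imsetP => -[].
  rewrite -card_b // -[RHS](card_imset _ (@inr_inj 'I_c _)).
  apply: eq_card => -[e|b]; rewrite inE /=.
    by apply/esym/imsetP => -[].
  by rewrite mem_imset ?inE //; apply: inr_inj.
- move=> [e|l] [e'|b] /=.
  + by rewrite mem_imset ?inE //; apply: inl_inj.
  + by apply/imsetP => -[].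
  + by apply/imsetP => -[].
  + by rewrite mem_imset ?bdE //; apply: inr_inj.
Qed.

Theorem theorem10 :
  (forall cs : seq nat,
     (1 <= size cs)%N -> (forall c, c \in cs -> (4 <= c)%N) ->
     [/\ value (chains cs) = controlled_value cs,
         controlled_value cs = 4 + \sum_(c <- cs) (c%:Z - 4) &
         4 + \sum_(c <- cs) (c%:Z - 4) >= 4])
  /\
  (forall cs : seq nat,
     (1 <= size cs)%N -> (forall c, c \in cs -> (3 <= c)%N) ->
     (1 <= controlled_value cs -> value (chains cs) = controlled_value cs)
     /\
     (controlled_value cs <= 0 ->
        (value (chains cs) = 1 \/ value (chains cs) = 2)
        /\ (value (chains cs) = controlled_value cs %[mod 2])%Z)).
Proof.
have partb cs (cs_gt0 : (1 <= size cs)%N)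
    (cs3 : forall c, c \in cs -> (3 <= c)%N) :=
  value_coded (chains_coding (fun c ccs => ltnW (ltnW (cs3 c ccs)))) cs3 cs_gt0.
split=> cs cs_gt0 cs_ge.
  have ge4 : 4 <= controlled_value cs.
    rewrite /controlled_value lerDl big_seq sumr_ge0 // => c /cs_ge; clear; lia.
  split=> //; have [] := partb cs cs_gt0 (fun c ccs => ltnW (cs_ge c ccs)).
  by move: ge4; clear; lia.
have [] := partb cs cs_gt0 cs_ge; move=> le_v v1 v_le v2 par.
split=> [c1|c0]; first by move: le_v v_le c1; clear; lia.
split; first by move: v1 (v2 c0); clear; lia.
by apply/eqP; rewrite eqz_mod_dvd.
Qed.
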